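(* Let $D\subset\mathbb R^d$ be a bounded domain, $p\in(0,1)$, $f\colon L^2(D)\to\mathbb R$ continuously differentiable, and $u_a,u_b\in L^2(D)$ with $u_a<0<u_b$ almost everywhere on $D$. Let $q(u):=\int_D|u(\omega)|^p\,\mathrm d\omega$ for $u\in L^2(D)$ and $C:=\{u\in L^2(D)\mid u_a\le u\le u_b\text{ a.e. on }D\}$. Let $\bar u\in L^2(D)$ be a local minimizer of the problem $\min_u\{f(u)+q(u)\mid u\in C\}$. Then there exists a function $\eta\in L^2(D)$ such that $$f'(\bar u)+\eta=0,$$ $$\eta=p|\bar u|^{p-2}\bar u\quad\text{a.e. on }\{\bar u\ne0\}\cap\{u_a<\bar u<u_b\},$$ $$\eta\le p|u_a|^{p-2}u_a\quad\text{a.e. on }\{\bar u=u_a\},$$ $$\eta\ge p|u_b|^{p-2}u_b\quad\text{a.e. on }\{\bar u=u_b\}.$$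
   Context: $L^2(D)$ is the usual Lebesgue space with its norm; its dual is identified with $L^2(D)$, so $f'(\bar u)\in L^2(D)$. Differentiability is in the Fréchet sense. Sets such as $\{\bar u\neq0\}$ denote $\{\omega\in D\mid\bar u(\omega)\neq0\}$, defined up to null sets. *)

(* Defs.v *)
From HB Require Import structures.
From mathcomp Require Import all_boot all_order all_algebra.
From mathcomp Require Import all_classical all_reals all_analysis.
From mathcomp Require Import measurable_realfun ess_sup_inf lra.
Set Implicit Arguments.
Unset Strict Implicit.
Unset Printing Implicit Defensive.
Import Order.TTheory GRing.Theory Num.Theory.
Import numFieldNormedType.Exports.
Local Open Scope classical_set_scope.
Local Open Scope ring_scope.

(* The library defines LspaceType mu p1 (classes of a.e. equal measurable
   functions with finite L^p norm) but gives it no algebraic structure. We make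
   it a normed module, so that the library's differentiable, 'd, nbhs and
   continuity apply to functionals on it. *)
Section Lspace_normed.
Context d (T : measurableType d) (R : realType).
Variables (mu : {measure set T -> \bar R}) (p : \bar R) (p1 : (1 <= p)%E).
Local Notation Lp := (LspaceType mu p1).
Local Notation Lf := (LfunType mu p1).

HB.instance Definition _ := gen_eqMixin Lp.
HB.instance Definition _ := gen_choiceMixin Lp.

Lemma Lspace_Lfun (u : Lp) : (u : T -> R) \in Lfun mu p.
Proof.
apply/andP; split; rewrite inE /=; last exact: Lebesgue_finite.
exact: (@measurable_funPT _ _ _ _ (repr (LebesgueSpace.sort u))).
Qed.

Definition Lspace_repr (u : Lp) : Lf := Lfun_Sub p1 (Lspace_Lfun u).

Lemma Lspace_reprE (u : Lp) : Lspace_repr u = u :> (T -> R).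
Proof. by []. Qed.

Lemma Lspace_eqP (u v : Lp) :
  u = v <-> (u : T -> R) = (v : T -> R) %[ae mu].
Proof.
split=> [->|uv]; first exact: ae_eq_refl.
case: u v uv => [u [[hu]]] [v [[hv]]] /= /asboolP uv.
have uvE : u = v.
  rewrite -[u]reprK -[v]reprK; apply/eqP; rewrite eqmodE.
  exact: uv.
by case: _ / uvE in hv uv *; rewrite (Prop_irrelevance hu hv).
Qed.

Lemma ae_eq_Lnorm (f g : T -> R) :
  measurable_fun setT f -> measurable_fun setT g -> f = g %[ae mu] ->
  Lnorm mu p (EFin \o f) = Lnorm mu p (EFin \o g).
Proof.
move=> mf mg fg; rewrite unlock; case: p p1 => [r r1|_|]; last by [].
- have mp (h : T -> R) : measurable_fun setT h ->
      measurable_fun setT (fun x => `|(h x)%:E| `^ r)%E.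
    move=> mh; apply: (@measurableT_comp _ _ _ _ _ _ (fun x => x `^ r)%E) => //=.
      exact: measurable_poweR.
    by apply/measurable_EFinP; exact: measurableT_comp.
  congr (_ `^ _)%E; apply: ae_eq_integral => //; [exact: mp|exact: mp|].
  by apply: filterS fg => x /= /[apply] ->.
- case: ifPn => // _; apply: eq_ess_sup.
  by apply: filterS fg => x /= /(_ I) ->.
Qed.

Section Lspace_of.
Variable f : Lf.

Let mf : measurable_fun [set: T] (f : T -> measurableTypeR R).
Proof. exact: (@measurable_funPT _ _ _ _ f). Qed.

Let m : {mfun T >-> measurableTypeR R} :=
  HB.pack (f : T -> measurableTypeR R) (isMeasurableFun.Build _ _ _ _ _ mf).

Let c : {mfun_ mu, T >-> measurableTypeR R} := (\pi m)%qT.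

Let cf : (c : T -> R) = f %[ae mu].
Proof.
have : ae_eq_op mu (repr c) m by rewrite -eqmodE reprK.
by move=> /asboolP.
Qed.

Let c_fin : finite_norm mu p (c : T -> R).
Proof.
rewrite /finite_norm (ae_eq_Lnorm _ _ cf).
- exact: Lfunction_finite.
- exact: (@measurable_funPT _ _ _ _ (repr c)).
- exact: (@measurable_funPT _ _ _ _ f).
Qed.

Definition Lspace_of : Lp :=
  HB.pack c (isFinLebesgue.Build d T R mu p p1 c c_fin).

Lemma Lspace_of_ae : (Lspace_of : T -> R) = f %[ae mu].
Proof. exact: cf. Qed.

End Lspace_of.

Lemma Lspace_reprK (u : Lp) : Lspace_of (Lspace_repr u) = u.
Proof. by apply/Lspace_eqP; exact: Lspace_of_ae. Qed.

Definition Lspace_zero : Lp := Lspace_of 0.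
Definition Lspace_opp (u : Lp) : Lp := Lspace_of (- Lspace_repr u).
Definition Lspace_add (u v : Lp) : Lp :=
  Lspace_of (Lspace_repr u + Lspace_repr v).
Definition Lspace_scale (a : R) (u : Lp) : Lp :=
  Lspace_of (a *: Lspace_repr u).
Definition Lspace_norm (u : Lp) : R := fine (Lnorm mu p (EFin \o u)).

Let zeroE : (Lspace_zero : T -> R) = cst 0 %[ae mu].
Proof. exact: Lspace_of_ae. Qed.

Let oppE u : (Lspace_opp u : T -> R) = (fun x => - u x) %[ae mu].
Proof. exact: Lspace_of_ae. Qed.

Let addE u v : (Lspace_add u v : T -> R) = (fun x => u x + v x) %[ae mu].
Proof. exact: Lspace_of_ae. Qed.

Let scaleE a u : (Lspace_scale a u : T -> R) = (fun x => a * u x) %[ae mu].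
Proof. exact: Lspace_of_ae. Qed.

Let addA : associative Lspace_add.
Proof.
move=> u v w; apply/Lspace_eqP.
move: (addE u (Lspace_add v w)) (addE v w) (addE (Lspace_add u v) w) (addE u v).
move=> k1 k2 k3 k4.
apply: filterS2 (filterI k1 k2) (filterI k3 k4).
move=> x [h1 h2] [h3 h4] _.
by rewrite (h1 I) (h2 I) (h3 I) (h4 I) addrA.
Qed.

Let addC : commutative Lspace_add.
Proof.
move=> u v; apply/Lspace_eqP; move: (addE u v) (addE v u).
by apply: filterS2 => x h1 h2 _; rewrite (h1 I) (h2 I) addrC.
Qed.

Let add0 : left_id Lspace_zero Lspace_add.
Proof.
move=> u; apply/Lspace_eqP; move: (addE Lspace_zero u) zeroE.
by apply: filterS2 => x h1 h2 _; rewrite (h1 I) (h2 I) add0r.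
Qed.

Let addN : left_inverse Lspace_zero Lspace_opp Lspace_add.
Proof.
move=> u; apply/Lspace_eqP; move: (addE (Lspace_opp u) u) (oppE u) zeroE.
by apply: filterS3 => x h1 h2 h3 _; rewrite (h1 I) (h2 I) (h3 I) addNr.
Qed.

HB.instance Definition _ := GRing.isZmodule.Build Lp addA addC add0 addN.

Let scaleA a b u :
  Lspace_scale a (Lspace_scale b u) = Lspace_scale (a * b) u.
Proof.
apply/Lspace_eqP.
move: (scaleE a (Lspace_scale b u)) (scaleE b u) (scaleE (a * b) u).
by apply: filterS3 => x h1 h2 h3 _; rewrite (h1 I) (h2 I) (h3 I) mulrA.
Qed.

Let scale1 : left_id 1 Lspace_scale.
Proof.
move=> u; apply/Lspace_eqP; move: (scaleE 1 u).
by apply: filterS => x h1 _; rewrite (h1 I) mul1r.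
Qed.

Let scaleDr : right_distributive Lspace_scale +%R.
Proof.
move=> a u v; apply/Lspace_eqP.
apply: filterS3 (addE u v) (filterI (scaleE a u) (scaleE a v))
  (filterI (scaleE a (u + v)) (addE (Lspace_scale a u) (Lspace_scale a v))).
move=> x h1 [h2 h3] [h4 h5] _.
by rewrite (h5 I) (h2 I) (h3 I) (h4 I) (h1 I) mulrDr.
Qed.

Let scaleDl u : {morph Lspace_scale^~ u : a b / a + b}.
Proof.
move=> a b; apply/Lspace_eqP.
move: (scaleE a u) (scaleE b u) (scaleE (a + b) u)
  (addE (Lspace_scale a u) (Lspace_scale b u)).
move=> k1 k2 k3 k4.
apply: filterS2 (filterI k1 k2) (filterI k3 k4).
move=> x [h1 h2] [h3 h4] _.
by rewrite (h4 I) (h3 I) (h2 I) (h1 I) mulrDl.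
Qed.

HB.instance Definition _ :=
  GRing.Zmodule_isLmodule.Build R Lp scaleA scale1 scaleDr scaleDl.

Lemma Lspace_zeroE : ((0 : Lp) : T -> R) = cst 0 %[ae mu].
Proof. exact: zeroE. Qed.

Lemma Lspace_oppE (u : Lp) : ((- u : Lp) : T -> R) = (fun x => - u x) %[ae mu].
Proof. exact: oppE. Qed.

Lemma Lspace_addE (u v : Lp) :
  ((u + v : Lp) : T -> R) = (fun x => u x + v x) %[ae mu].
Proof. exact: addE. Qed.

Lemma Lspace_scaleE (a : R) (u : Lp) :
  ((a *: u : Lp) : T -> R) = (fun x => a * u x) %[ae mu].
Proof. exact: scaleE. Qed.

Let normE (f : Lf) : Lspace_norm (Lspace_of f) = fine (Lnorm mu p (EFin \o f)).
Proof.
congr fine; apply: ae_eq_Lnorm; last exact: Lspace_of_ae.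
- exact: (@measurable_funPT _ _ _ _ (repr (LebesgueSpace.sort (Lspace_of f)))).
- exact: (@measurable_funPT _ _ _ _ f).
Qed.

Let normD (u v : Lp) :
  Lspace_norm (u + v) <= Lspace_norm u + Lspace_norm v.
Proof. by rewrite normE; exact: ler_LnormD. Qed.

Let normZ (a : R) (u : Lp) : Lspace_norm (a *: u) = `|a| * Lspace_norm u.
Proof.
rewrite normE.
transitivity (fine (`|a|%:E * Lnorm mu p (EFin \o Lspace_repr u))).
  by congr fine; exact: (LnormZ (Lspace_repr u) a).
by rewrite -finite_norm_fine.
Qed.

Let norm0 (u : Lp) : Lspace_norm u = 0 -> u = 0.
Proof.
move=> u0; apply/Lspace_eqP.
move: (@fine_Lnormr_eq0 _ _ _ _ _ _ (Lspace_repr u) u0) zeroE.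
by apply: filterS2 => x h1 h2 _; exact: etrans (h1 I) (esym (h2 I)).
Qed.

HB.instance Definition _ := Lmodule_isNormed.Build R Lp normD normZ norm0.

Lemma Lspace_normE (u : Lp) : `|u| = fine (Lnorm mu p (EFin \o u)).
Proof. by []. Qed.

End Lspace_normed.

(* Lebesgue measure on R^(n+1): the outer measure obtained from countable covers
   by half-open boxes, restricted to its Caratheodory-measurable sets. The
   dimension is positive because 'rV_0 is a single point, which every box fills
   with volume 1 (empty product). *)
Section lebesgue_rV.
Context (R : realType) (n : nat).
Local Notation rV := 'rV[R]_n.+1.
Implicit Types (a b x : rV) (A X : set rV) (B : nat -> rV * rV).

Definition rV_box (ab : rV * rV) : set rV :=
  [set x | forall i, ab.1 0 i <= x 0 i < ab.2 0 i].

Definition rV_box_vol (ab : rV * rV) : R :=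
  \prod_i Num.max 0 (ab.2 0 i - ab.1 0 i).

Definition rV_box_cover A B := A `<=` \bigcup_k rV_box (B k).

Local Open Scope ereal_scope.

Definition rV_outer A : \bar R :=
  ereal_inf [set \sum_(k <oo) (rV_box_vol (B k))%:E | B in rV_box_cover A].

Lemma rV_box_vol_ge0 ab : (0 <= rV_box_vol ab)%R.
Proof. by apply: prodr_ge0 => i _; rewrite le_max lexx. Qed.

Let vol_ge0 ab : 0 <= (rV_box_vol ab)%:E.
Proof. by rewrite lee_fin rV_box_vol_ge0. Qed.

Let rV_outer_ge0 A : 0 <= rV_outer A.
Proof.
apply: le_ereal_inf_tmp => _ [B _ <-]; apply: nneseries_ge0 => k _ _; exact: vol_ge0.
Qed.

Let rV_outer0 : rV_outer set0 = 0.
Proof.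
apply/eqP; rewrite eq_le rV_outer_ge0 andbT; apply: ereal_inf_lbound.
exists (fun=> (0%R, 0%R)) => //.
rewrite eseries0// => k _ _; rewrite /rV_box_vol /=.
by rewrite big_ord_recl subrr maxxx mul0r.
Qed.

Let le_rV_outer : {homo rV_outer : A X / A `<=` X >-> A <= X}.
Proof.
move=> A X AX; apply: ereal_inf_le_tmp => _ [B XB <-].
by exists B => //; exact: subset_trans XB.
Qed.

Let rV_outer_sub : sigma_subadditive rV_outer.
Proof.
move=> A; have [[i ioo]|] := pselect (exists i, rV_outer (A i) = +oo).
  rewrite (eseries_pinfty _ _ ioo) ?leey// => k _.
  by rewrite -ltNye (lt_le_trans _ (rV_outer_ge0 _)).
rewrite -forallNE => Aoo.
suff add2e (e : {posnum R}) :
    rV_outer (\bigcup_n A n) <= \sum_(i <oo) rV_outer (A i) + e%:num%:E.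
  by apply/lee_addgt0Pr => _/posnumP[].
rewrite (le_trans _ (epsilon_trick _ _ _))//.
pose P k B := rV_box_cover (A k) B /\
  \sum_(i <oo) (rV_box_vol (B i))%:E <=
  rV_outer (A k) + (e%:num / (2 ^ k.+1)%:R)%:E.
have [G PG] : {G : nat -> nat -> rV * rV & forall k, P k (G k)}.
  apply: (@choice _ _ P) => k; rewrite /P /rV_outer.
  set S := (X in ereal_inf X); move infS : (ereal_inf S) => iS.
  case: iS infS => [r Sr|Soo|Soo].
  - have en1 : (0 < e%:num / (2 ^ k.+1)%:R)%R by [].
    have /(lb_ereal_inf_adherent en1) : ereal_inf S \is a fin_num by rewrite Sr.
    move=> [x [B AB xE] xS].
    by exists B; split => //; rewrite -Sr xE; exact/ltW.
  - by have := Aoo k; rewrite /rV_outer -/S Soo.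
  - have := rV_outer_ge0 (A k).
    by rewrite /rV_outer -/S Soo.
pose v (ij : nat * nat) := (rV_box_vol (G ij.1 ij.2))%:E.
have v0 ij : 0 <= v ij by exact: vol_ge0.
apply: (@le_trans _ _ (\esum_(i in setT) v i)).
  apply: ereal_inf_lbound => /=.
  have /card_esym/ppcard_eqP[f] := card_nat2.
  exists (fun k => G (f k).1 (f k).2).
    apply: (@subset_trans _  (\bigcup_n \bigcup_k rV_box (G n k))).
      by move=> t [i _ /(PG i).1 [j _ ?]]; exists i => //; exists j.
    move=> t [i _ [j _ Bijt]]; exists (f^-1%FUN (i, j)) => //=.
    by rewrite invK ?inE.
  rewrite -(esum_pred_image v _ xpredT) ?[fun=> _]set_true//.
  by rewrite image_eq.
rewrite (_ : esum _ _ = \sum_(i <oo) \sum_(j <oo ) v (i, j)); last first.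
  pose J : nat -> set (nat * nat) := fun i => [set (i, j) | j in setT].
  rewrite (_ : setT = \bigcup_k J k); last first.
    by rewrite predeqE => -[a b]; split => // _; exists a => //; exists b.
  rewrite esum_bigcupT /=; last 2 first.
    - apply/trivIsetP => i j _ _ ij.
      rewrite predeqE => -[k m] /=; split => //= -[] [_] _ [<-{k} _].
      by move=> [m' _] [] /esym/eqP; rewrite (negbTE ij).
    - by [].
  rewrite -(image_id [set: nat]) -fun_true esum_pred_image//; last first.
    by move=> k _; exact: esum_ge0.
  apply: eq_eseriesr => /= j _.
  rewrite -(esum_pred_image v (pair j) predT)//=; last first.
    by move=> ? ? _ _; exact: (@can_inj _ _ _ snd).
  by congr esum; rewrite predeqE => -[a b]; split; move=> [i _ <-]; exists i.
apply: lee_nneseries => [k _ _|k _]; last exact: (PG k).2.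
by apply: nneseries_ge0 => m _ _; exact: v0.
Qed.

HB.instance Definition _ := isOuterMeasure.Build R rV rV_outer
  rV_outer0 rV_outer_ge0 le_rV_outer rV_outer_sub.

Definition lebesgue_outer : {outer_measure set rV -> \bar R} := rV_outer.

Definition lebesgue_rV :
    {measure set (caratheodory_type lebesgue_outer) -> \bar R} :=
  lebesgue_outer.


Lemma rV_halfspace_measurable (i : 'I_n.+1) (c : R) :
  lebesgue_outer.-cara.-measurable [set x | (x 0%R i < c)%R].
Proof.
set H := [set x | _].
apply: le_caratheodory_measurable => X /=.
apply: le_ereal_inf_tmp => _ [B XB <-].
pose L (ab : rV * rV) : rV * rV :=
  (ab.1, \row_j if j == i then Num.min (ab.2 0%R j) c else ab.2 0%R j).
pose U (ab : rV * rV) : rV * rV :=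
  (\row_j (if j == i then Num.max (ab.1 0%R j) c else ab.1 0%R j), ab.2).
have volE ab : (rV_box_vol ab = rV_box_vol (L ab) + rV_box_vol (U ab))%R.
  rewrite /rV_box_vol (bigD1 i)//= [in X in _ = (X + _)%R](bigD1 i)//=.
  rewrite [in X in _ = (_ + X)%R](bigD1 i)//= !mxE eqxx.
  set p := (X in (_ * X = _)%R).
  rewrite [X in (_ = _ * X + _)%R](_ : _ = p); last first.
    by apply: eq_bigr => j /negbTE ji; rewrite mxE ji.
  rewrite [X in (_ = _ + _ * X)%R](_ : _ = p); last first.
    by apply: eq_bigr => j /negbTE ji; rewrite mxE ji.
  rewrite -mulrDl; congr (_ * _)%R.
  move: (ab.1 0%R i) (ab.2 0%R i) => s t.
  rewrite /Num.min /Num.max.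
  repeat case: ifP; lra.
rewrite (eq_eseriesr (g := fun k =>
    (rV_box_vol (L (B k)))%:E + (rV_box_vol (U (B k)))%:E)); last first.
  by move=> k _; rewrite -EFinD volE.
rewrite nneseriesD//; apply: leeD; apply: ereal_inf_lbound.
- exists (fun k => L (B k)) => // x [/XB[k _ xk] xc]; exists k => // j /=.
  have /andP[-> xb] := xk j; rewrite mxE; case: eqVneq => //= ji.
  by rewrite lt_min xb ji.
- exists (fun k => U (B k)) => // x [/XB[k _ xk] /negP]; rewrite -leNgt => xc; exists k => // j /=.
  have /andP[xa ->] := xk j; rewrite andbT mxE; case: eqVneq => //= ji.
  by rewrite ge_max xa ji.
Qed.

Lemma rV_box_measurable (ab : rV * rV) : lebesgue_outer.-cara.-measurable (rV_box ab).
Proof.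
have -> : rV_box ab = \bigcap_(i in [set: 'I_n.+1])
   ([set x : rV | (x 0 i < ab.2 0 i)%R] `\` [set x | (x 0 i < ab.1 0 i)%R]).
  apply/seteqP; split=> x /= xab i.
    by move=> _; have /andP[x1 x2] := xab i; split=> //=; apply/negP; rewrite -leNgt.
  by have [x2 /negP] := xab i I; rewrite -leNgt => ->.
apply: (@fin_bigcap_measurable _ (caratheodory_type lebesgue_outer)).
  exact: finite_finset.
move=> i _; apply: measurableD; exact: rV_halfspace_measurable.
Qed.

Lemma rV_open_measurable (D : set rV) : open D -> lebesgue_outer.-cara.-measurable D.
Proof.
move=> oD.
pose e (k : nat) : R := (k.+1%:R^-1)%R.
pose bx (qk : 'rV[rat]_n.+1 * nat) : rV * rV :=
  (\row_j (ratr (qk.1 0 j) - e qk.2)%R, \row_j (ratr (qk.1 0 j) + e qk.2)%R).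
pose F qk := if `[< rV_box (bx qk) `<=` D >] then rV_box (bx qk) else set0.
have -> : D = \bigcup_qk F qk.
  apply/seteqP; split=> [x Dx|x [qk _]]; last first.
    by rewrite /F; case: asboolP => // bxD; exact: bxD.
  have := open_nbhs_nbhs (conj oD Dx) => /nbhs_ballP[r /= r0 rD].
  have [k kr] : exists k, (e k < r / 2)%R.
    have r20 : (0 < r / 2)%R by rewrite divr_gt0.
    have [k _ /(_ k (leqnn _)) H] := near_infty_natSinv_lt (PosNum r20).
    by exists k.
  have ek0 : (0 < e k)%R by rewrite invr_gt0.
  have [q qx] : exists q : 'rV[rat]_n.+1, forall i,
      (x 0 i - e k < ratr (q 0 i) < x 0 i + e k)%R.
    have H i : {q : rat | (x 0%R i - e k < ratr q < x 0%R i + e k)%R}.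
      apply: cid; have [|q] := @rat_in_itvoo R (x 0%R i - e k)%R (x 0%R i + e k)%R.
        lra.
      by rewrite in_itv /= => ?; exists q.
    by exists (\row_i sval (H i)) => i; rewrite mxE; exact: (svalP (H i)).
  exists (q, k) => //; rewrite /F; case: asboolP => [_ i|[]].
    by rewrite !mxE /=; have := qx i; lra.
  move=> y yb; apply: rD; split=> // i j; rewrite (ord1 i).
  have := yb j; have := qx j; rewrite !mxE /= /ball /= => H1 H2.
  rewrite ltr_norml; lra.
apply: (@countable_bigcupT_measurable _ (caratheodory_type lebesgue_outer)) => //.
move=> qk; rewrite /F; case: ifP => _; last exact: measurable0.
exact: rV_box_measurable.
Qed.
End lebesgue_rV.
Arguments lebesgue_rV {R n}.

Section L2_of_domain.
Context (R : realType) (n : nat) (D : set 'rV[R]_n.+1) (oD : open D).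

(* Functions are defined on the whole space but identified when they agree
   almost everywhere on D, so their values outside D are irrelevant. *)
Definition L2 : Type :=
  LspaceType2 (mrestr lebesgue_rV (rV_open_measurable oD)).

Definition L2_dot (u v : L2) : R := \int[lebesgue_rV]_(x in D) (u x * v x).

Definition Lp_penalty (p : R) (u : L2) : R :=
  \int[lebesgue_rV]_(x in D) (`|u x| `^ p).

Definition box_constraint (ua ub : L2) : set L2 :=
  [set u | {ae lebesgue_rV, forall x, D x -> ua x <= u x <= ub x}].

End L2_of_domain.

(* Frechet differentiable everywhere, with 'd f continuous for the operator
   norm. *)
Definition continuously_differentiable (R : realType) (V W : normedModType R)
    (f : V -> W) : Prop :=
  (forall u, differentiable f u) /\
  (forall u (e : R), 0 < e ->
    \forall v \near u, forall h, `|'d f v h - 'd f u h| <= e * `|h|).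

Definition local_minimizer (R : realType) (V : normedModType R)
    (C : set V) (J : V -> R) (u : V) : Prop :=
  C u /\ \forall v \near u, C v -> J u <= J v.

(* Main.v *)
(* Let eta represent - f'(ubar) in L^2(D). Where ubar <> 0 and ubar + r satisfies
   the box constraint for some r <> 0 with |r| <= |ubar|, perturb ubar by
   t r 1_B, 0 < t < 1. As s |-> |s|^p is concave on each half-line, its tangent
   at ubar bounds the change of the penalty from above, so minimality of ubar gives
   0 <= f'(ubar)(r 1_B) + int_B r psi = int_B r (psi - eta) with
   psi = p |ubar|^(p-2) ubar, without differentiating the penalty. Taking for B
   the set where r (psi - eta) < 0 yields r (psi - eta) >= 0 a.e., and
   r = 1/(k+1), -1/(k+1) give eta <= psi where ubar < ub and eta >= psi where
   ua < ubar. The Riesz representative is the Radon-Nikodym density g of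
   A |-> l(1_A); its square integrability follows by testing l on simple
   functions 0 <= s <= g^+, for which |s|^2 <= int g s = l(s) <= M |s|. *)
Require Import Defs.
From HB Require Import structures.
From mathcomp Require Import all_boot all_order all_algebra.
From mathcomp Require Import all_classical all_reals all_analysis.
From mathcomp Require Import measurable_realfun ring lra.
Set Implicit Arguments.
Unset Strict Implicit.
Unset Printing Implicit Defensive.
Import Order.TTheory GRing.Theory Num.Theory.
Import numFieldNormedType.Exports HBNNSimple.
Local Open Scope classical_set_scope.
Local Open Scope ring_scope.

(** * Square-integrable functions and their classes in [L2] *)

Section square_integrable.
Context d (T : measurableType d) (R : realType) (mu : {measure set T -> \bar R}).
Local Notation L2 := (LspaceType2 mu).
Implicit Types f g : T -> R.

Lemma Lfun2_measurable f : f \in Lfun mu 2%:E -> measurable_fun setT f.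
Proof. by move=> /andP[/[!inE]]. Qed.

Lemma Lfun2_sqr_lty f : measurable_fun setT f ->
  (\int[mu]_x (f x ^+ 2)%:E < +oo)%E -> f \in Lfun mu 2%:E.
Proof.
move=> mf fi; apply/andP; split; rewrite inE//= /finite_norm unlock poweR_lty//.
by under eq_integral do rewrite /= powR_mulrn// -normrX ger0_norm ?sqr_ge0//.
Qed.

Lemma le_Lfun2 f g : measurable_fun setT f -> g \in Lfun mu 2%:E ->
  (forall x, `|f x| <= `|g x|) -> f \in Lfun mu 2%:E.
Proof.
move=> mf lg fg; apply: Lfun2_sqr_lty => //.
have /integrableP[mg2] := Lfun2_integrable_sqr lg; apply: le_lt_trans.
apply: ge0_le_integral => //=.
- by move=> x _; rewrite lee_fin sqr_ge0.
- by apply/measurable_EFinP; exact: measurable_funX.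
- by apply/measurable_EFinP; apply: measurableT_comp => //; exact/measurable_EFinP.
- by move=> x _; rewrite lee_fin normrX -(real_normK (num_real (f x))) lerXn2r ?nnegrE.
Qed.

Lemma Lspace_Lfun2 (u : L2) : (u : T -> R) \in Lfun mu 2%:E.
Proof. exact: Lspace_Lfun. Qed.

Lemma Lspace2_norm_sqr (u : L2) :
  (`|u| ^+ 2)%:E = (\int[mu]_x (u x ^+ 2)%:E)%E.
Proof.
rewrite Lspace_normE.
transitivity (\int[mu]_x (`|(u x)%:E| `^ 2))%E; last first.
  by apply: eq_integral => x _; rewrite abse_EFin poweR_EFin powR_mulrn// -normrX ger0_norm ?sqr_ge0.
rewrite -powR_Lnorm//.
have := finite_norm_fine (Lspace_repr u); rewrite /= => <-.
by rewrite poweR_EFin powR_mulrn// fine_ge0// Lnorm_ge0.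
Qed.

(* Junk value [0] when [f] is not square integrable. *)
Definition Lspace_class f : L2 :=
  if pselect (f \in Lfun mu 2%:E) is left lf then Lspace_of (Lfun_Sub (lee1n 2) lf)
  else 0.

Lemma Lspace_classE f : f \in Lfun mu 2%:E ->
  (Lspace_class f : T -> R) = f %[ae mu].
Proof.
rewrite /Lspace_class; case: pselect => // lf _.
exact: Lspace_of_ae.
Qed.

Lemma Lspace_class_ae f (u : L2) : f \in Lfun mu 2%:E ->
  f = u %[ae mu] -> Lspace_class f = u.
Proof.
move=> lf fu; apply/Lspace_eqP.
exact: ae_eq_trans (Lspace_classE lf) fu.
Qed.

Lemma Lspace_classK (u : L2) : Lspace_class u = u.
Proof. by apply: Lspace_class_ae; [exact: Lspace_Lfun2|exact: ae_eq_refl]. Qed.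

Lemma Lfun2D f g : f \in Lfun mu 2%:E -> g \in Lfun mu 2%:E ->
  (fun x => f x + g x) \in Lfun mu 2%:E.
Proof.
move=> lf lg.
have [_ H] := Lfun_addr_closed mu (lee1n 2 : 1 <= 2%:E)%E.
exact: H.
Qed.

Lemma Lfun2Z a f : f \in Lfun mu 2%:E -> (fun x => a * f x) \in Lfun mu 2%:E.
Proof.
move=> lf; have := @Lfun_scale _ _ _ mu f a 2 _ lf.
rewrite ler1n => /(_ isT).
by rewrite (_ : a \o* f = (fun x => a * f x))//; apply/funext => x /=; rewrite mulrC.
Qed.

Lemma Lspace_classD f g : f \in Lfun mu 2%:E -> g \in Lfun mu 2%:E ->
  Lspace_class (fun x => f x + g x) = Lspace_class f + Lspace_class g.
Proof.
move=> lf lg; apply: Lspace_class_ae; first exact: Lfun2D.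
move: (Lspace_classE lf) (Lspace_classE lg)
  (Lspace_addE (Lspace_class f) (Lspace_class g)).
apply: filterS3 => x fE gE DE _.
by rewrite (DE I) (fE I) (gE I).
Qed.

Lemma Lspace_classZ a f : f \in Lfun mu 2%:E ->
  Lspace_class (fun x => a * f x) = a *: Lspace_class f.
Proof.
move=> lf; apply: Lspace_class_ae; first exact: Lfun2Z.
move: (Lspace_classE lf) (Lspace_scaleE a (Lspace_class f)).
by apply: filterS2 => x fE ZE _; rewrite (ZE I) (fE I).
Qed.

Lemma Lspace_class0 : Lspace_class (fun=> 0) = 0.
Proof.
have l0 : (fun=> 0) \in Lfun mu 2%:E.
  by apply: Lfun2_sqr_lty => //; under eq_integral do rewrite expr0n/=; rewrite integral0 ltry.
apply: Lspace_class_ae => //; apply: ae_eq_sym; exact: Lspace_zeroE.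
Qed.

Lemma Lspace_class_norm_sqr f : f \in Lfun mu 2%:E ->
  (`|Lspace_class f| ^+ 2)%:E = (\int[mu]_x (f x ^+ 2)%:E)%E.
Proof.
move=> lf; rewrite Lspace2_norm_sqr; apply: ae_eq_integral => //.
- apply/measurable_EFinP; apply: measurable_funX; exact/Lfun2_measurable/Lspace_Lfun2.
- apply/measurable_EFinP; apply: measurable_funX; exact/Lfun2_measurable.
by move: (Lspace_classE lf); apply: filterS => x fE _; rewrite (fE I).
Qed.

(** The [L2] distance is the square root of the integral of [(f - f_ n) ^ 2], which is dominated by
    [4 * g ^ 2]. This turns pointwise limits into limits along a continuous functional. *)
Lemma Lspace_class_dominated_cvg (f_ : (T -> R)^nat) f g :
  (forall n, measurable_fun setT (f_ n)) ->
  (forall x, f_ ^~ x @ \oo --> f x) ->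
  g \in Lfun mu 2%:E -> (forall n x, `|f_ n x| <= g x) ->
  [/\ f \in Lfun mu 2%:E, forall n, f_ n \in Lfun mu 2%:E &
    Lspace_class (f_ n) @[n --> \oo] --> Lspace_class f].
Proof.
move=> mf_ f_f lg fg.
have g0 x : 0 <= g x by exact: le_trans (fg 0%N x).
have mf : measurable_fun setT f.
  by apply: (measurable_fun_cvg mf_) => x _; exact: f_f.
have fleg x : `|f x| <= g x.
  have -> : `|f x| = limn (fun n => `|f_ n x|).
    by apply/esym/cvg_lim => //; apply: cvg_norm; exact: f_f.
  apply: limr_le; last by apply: nearW => n; exact: fg.
  by apply/cvg_ex; exists `|f x|; apply: cvg_norm; exact: f_f.
have lf_ n : f_ n \in Lfun mu 2%:E.
  by apply: le_Lfun2 lg _ => // x; rewrite (ger0_norm (g0 x)).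
have lf : f \in Lfun mu 2%:E.
  by apply: le_Lfun2 lg _ => // x; rewrite (ger0_norm (g0 x)).
split => //.
have lB n : (fun x => f x + -1 * f_ n x) \in Lfun mu 2%:E by apply: Lfun2D => //; exact: Lfun2Z.
have BE n : `|Lspace_class f - Lspace_class (f_ n)| =
    Num.sqrt (fine (\int[mu]_x ((f x - f_ n x) ^+ 2)%:E)%E).
  rewrite -scaleN1r -Lspace_classZ// -Lspace_classD//; last exact: Lfun2Z.
  under eq_integral do rewrite -mulN1r.
  by rewrite -Lspace_class_norm_sqr// sqrtr_sqr normr_id.
apply/cvgrPdist_lt.
suff : Num.sqrt (fine (\int[mu]_x ((f x - f_ n x) ^+ 2)%:E)%E) @[n --> \oo] --> (0 : R).
  move=> /cvgrPdist_lt h e e0; near=> n; rewrite BE.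
  have : `|0 - Num.sqrt (fine (\int[mu]_x ((f x - f_ n x) ^+ 2)%:E)%E)| < e by near: n; exact: h.
  by rewrite sub0r normrN ger0_norm ?sqrtr_ge0.
rewrite -[X in _ --> X]sqrtr0; apply: continuous_cvg; first exact: sqrt_continuous.
rewrite -[X in _ --> X]/(fine 0%:E); apply: fine_cvg.
rewrite -[X in _ --> X](integral0 mu setT).
apply: (@dominated_cvg _ _ _ mu setT measurableT _ _ (fun x => (4 * g x ^+ 2)%:E)) => //.
- move=> n; apply/measurable_EFinP; apply: measurable_funX; exact: measurable_funB.
- move=> x _; apply: cvg_EFin; first by apply: nearW.
  rewrite -[X in _ --> X](_ : (f x - f x) ^+ 2 = 0); last by rewrite subrr expr0n.
  apply: (@cvg_comp _ _ _ _ (fun y : R => y ^+ 2)); last exact: exprn_continuous.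
  by apply: cvgB; [exact: cvg_cst|exact: f_f].
- under eq_fun do rewrite EFinM.
  by apply: integrableZl => //; exact: Lfun2_integrable_sqr.
- move=> n x _; rewrite abse_EFin lee_fin normrX.
  rewrite (_ : 4 * g x ^+ 2 = (g x + g x) ^+ 2); last by ring.
  rewrite lerXn2r ?nnegrE ?addr_ge0//.
  by rewrite (le_trans (ler_normB _ _))// lerD.
Unshelve. all: by end_near. Qed.

End square_integrable.

(** * Riesz representation on [L2] of a finite measure *)

Section riesz.
Context d (T : measurableType d) (R : realType) (mu : {measure set T -> \bar R}).
Hypothesis muT : mu setT \is a fin_num.
Local Notation L2 := (LspaceType2 mu).
Local Notation Lclass := (@Lspace_class d T R mu).

Let mu_fin : fin_num_fun mu.
Proof.
move=> A mA; rewrite ge0_fin_numE//; apply: (le_lt_trans (le_measure _ _ _ (@subsetT _ A))).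
- by rewrite inE.
- by rewrite inE.
- by rewrite ltey_eq muT.
Qed.

Lemma bounded_Lfun2 (f : T -> R) M : measurable_fun setT f ->
  (forall x, `|f x| <= M) -> f \in Lfun mu 2%:E.
Proof.
move=> mf fM; have lM : cst M \in Lfun mu 2%:E.
  apply: Lfun2_sqr_lty => //=; rewrite integral_cst// ltey_eq fin_numM//.
by apply: le_Lfun2 lM _ => // x; exact: le_trans (fM x) (ler_norm _).
Qed.

Lemma indic_Lfun2 (A : set T) : measurable A -> \1_A \in Lfun mu 2%:E.
Proof.
move=> mA; apply: (@bounded_Lfun2 _ 1) => // x.
by rewrite indicE; case: (x \in A); rewrite /= ?normr1 ?normr0.
Qed.

Lemma Radon_Nikodym_finite_measure (nu : {charge set T -> \bar R}) : nu `<< mu ->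
  exists g : T -> R, mu.-integrable setT (EFin \o g) /\
    forall A, measurable A -> nu A = (\int[mu]_(x in A) (g x)%:E)%E.
Proof.
move=> numu.
(* Restricting [mu] to [setT] changes no value, and the copy can be given a finite-measure
   structure, under which [Radon_Nikodym] applies. *)
have rE A : mrestr mu measurableT A = mu A by rewrite /mrestr setIT.
have r_fin : fin_num_fun (mrestr mu measurableT).
  by move=> A mA; rewrite rE mu_fin.
pose m : {finite_measure set T -> \bar R} := HB.pack (mrestr mu measurableT)
  (@Measure_isFinite.Build d T R (mrestr mu measurableT) r_fin).
have nm : nu `<< m.
  by move=> N mN; apply: numu => A mA AN; rewrite -rE; exact: mN.
have gE : EFin \o (fun x => fine (Radon_Nikodym nu m x)) = Radon_Nikodym nu m.
  by apply/funext => x /=; rewrite fineK// Radon_Nikodym_fin_num.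
have mE (A : set T) (h : T -> \bar R) :
    (\int[m]_(x in A) h x = \int[mu]_(x in A) h x)%E.
  by apply: eq_measure_integral => B _ _; exact: rE.
exists (fun x => fine (Radon_Nikodym nu m x)); split.
  rewrite gE; have /integrableP[mg gfin] := Radon_Nikodym_integrable nm.
  by apply/integrableP; split=> //; rewrite -mE.
move=> A mA; rewrite (Radon_Nikodym_integral nm mA) mE.
by apply: eq_integral => x _; rewrite fineK// Radon_Nikodym_fin_num.
Qed.

Variables (l : L2 -> R) (M : R).
Hypothesis lP : forall a u v, l (a *: u + v) = a * l u + l v.
Hypothesis lM : forall u, `|l u| <= M * `|u|.

Let l0 : l 0 = 0.
Proof.
have := lP 1 0 0; rewrite scaler0 addr0 mul1r.
lra.
Qed.

Let lD u v : l (u + v) = l u + l v.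
Proof. by have := lP 1 u v; rewrite scale1r mul1r. Qed.

Let lZ a u : l (a *: u) = a * l u.
Proof. by have := lP a u 0; rewrite addr0 l0 addr0. Qed.

Let lB u v : l (u - v) = l u - l v.
Proof. by rewrite -scaleN1r lD lZ mulN1r. Qed.

Let l_cvg (u_ : L2^nat) (u : L2) : u_ n @[n --> \oo] --> u ->
  l (u_ n) @[n --> \oo] --> l u.
Proof.
move=> /cvgrPdist_lt uu; apply/cvgrPdist_lt => e e0.
(* [M] may be zero or negative, so [|M| + 1] serves as a positive Lipschitz constant. *)
have M0 : 0 < `|M| + 1 by rewrite ltr_wpDl.
near=> n; rewrite -lB (le_lt_trans (lM _))//.
apply: (@le_lt_trans _ _ ((`|M| + 1) * `|u - u_ n|)).
  by rewrite ler_wpM2r// (le_trans (ler_norm _))// lerDl.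
rewrite mulrC -ltr_pdivlMr//.
by near: n; apply: uu; rewrite divr_gt0.
Unshelve. all: by end_near. Qed.

(** The set function whose density will represent [l]; it may take both signs, hence a charge. *)
Let nu (A : set T) : \bar R := (l (Lclass \1_A))%:E.

Let nu0 : nu set0 = 0%E.
Proof. by rewrite /nu indic0 Lspace_class0 l0. Qed.

Let nu_fin A : measurable A -> nu A \is a fin_num.
Proof. by []. Qed.

(** Partial sums of the indicators converge pointwise to the indicator of the union and are bounded
    by 1, which is square integrable because [mu] is finite. They therefore converge in [L2], where
    [l] is continuous. *)
Let nu_sigma_additive : semi_sigma_additive nu.
Proof.
move=> F mF tF mU.
pose s n (x : T) := \sum_(0 <= i < n) \1_(F i) x : R.
(* Disjointness makes each partial sum an indicator, whence both the bound 1 and the pointwise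
   limit. *)
have sE n : s n = \1_(\big[setU/set0]_(0 <= i < n) F i).
  apply/funext => x; rewrite /s.
  elim: n => [|n IH]; first by rewrite !big_geq// indic0.
  rewrite !big_nat_recr//= IH !indicE in_setU.
  have [xn|xn] := boolP (x \in F n); last by rewrite orbF addr0.
  rewrite orbT memNset ?add0r// => /=.
  rewrite big_mkord -bigcup_mkord => -[i /= ilt xi].
  move: (tF i n I I) => /(_ _)/eqP.
  rewrite (ltn_eqF ilt) => H; apply: notF; apply: H.
  by exists x; split=> //; exact/set_mem.
have ms n : measurable_fun setT (s n).
  by apply: measurable_sum => i; exact: measurable_indic.
have s_U x : s ^~ x @ \oo --> (\1_(\bigcup_n F n) x : R).
  apply: cvg_near_cst.
  have [[k _ Fkx]|nF] := pselect ((\bigcup_n F n) x); last first.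
    apply: nearW => n; rewrite [in RHS]indicE memNset// sE indicE memNset//.
    by rewrite big_mkord -bigcup_mkord => -[i /= _ Fi]; apply: nF; exists i.
  near=> n; rewrite [in RHS]indicE mem_set//; last by exists k.
  rewrite sE indicE mem_set//= big_mkord -bigcup_mkord; exists k => //=.
  by near: n; exact: nbhs_infty_gt.
have s1 n x : `|s n x| <= 1.
  by rewrite sE indicE; case: (x \in _); rewrite /= ?normr1 ?normr0.
have [_ ls lcvg] := @Lspace_class_dominated_cvg _ _ _ mu s _ (cst 1) ms s_U
  (@bounded_Lfun2 (cst 1) `|1| (@measurable_cst _ _ _ _ _ _) (fun=> lexx _))
  (fun n x => s1 n x).
have nuE : (fun n => \sum_(0 <= i < n) nu (F i))%E = (fun n => (l (Lclass (s n)))%:E).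
  apply/funext => n; rewrite sumEFin; congr _%:E.
  elim: n => [|n IH].
    rewrite big_geq// (_ : s 0%N = fun=> 0) ?Lspace_class0 ?l0//.
    by apply/funext => x; rewrite /s big_geq.
  rewrite big_nat_recr//= IH -lD -Lspace_classD//; last exact: indic_Lfun2.
  by congr (l (Lclass _)); apply/funext => x; rewrite /s big_nat_recr.
rewrite nuE; apply: cvg_EFin; first exact: nearW.
exact: l_cvg.
Unshelve. all: by end_near. Qed.

HB.instance Definition _ := isCharge.Build d T R nu nu0 nu_fin nu_sigma_additive.

Let nu_mu : nu `<< mu.
Proof.
move=> N muN A mA AN; rewrite /nu.
suff -> : Lclass \1_A = 0 by rewrite l0.
apply: Lspace_class_ae; first exact: indic_Lfun2.
have A0 : mu A = 0%E by exact: muN.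
have : {ae mu, forall x, ~ A x} by exists A; split=> // x /= /contrapT.
apply: filterS2 (Lspace_zeroE mu (lee1n 2)) => x zE nAx _.
by rewrite (zE I) indicE memNset.
Qed.

Let l_density : exists g : T -> R, mu.-integrable setT (EFin \o g) /\
  forall A, measurable A -> l (Lclass \1_A) = \int[mu]_x (g x * \1_A x).
Proof.
have [g [gi gE]] := Radon_Nikodym_finite_measure nu_mu.
exists g; split=> // A mA.
transitivity (fine (nu A)) => //; rewrite gE// [in RHS]/Rintegral.
rewrite integral_mkcond; congr fine; apply: eq_integral => x _.
by rewrite patchE /= indicE; case: (x \in A); rewrite ?mulr1 ?mulr0.
Qed.

Lemma nnsfun_Lfun2 (s : {nnsfun T >-> R}) : (s : T -> R) \in Lfun mu 2%:E.
Proof.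
have [C [Cr sC]] := simple_bounded s.
by apply: (@bounded_Lfun2 _ (C + 1)) => // x; apply: sC => //; rewrite ltrDl.
Qed.

Let l_nnsfun (g : T -> R) (s : {nnsfun T >-> R}) :
  mu.-integrable setT (EFin \o g) ->
  (forall A, measurable A -> l (Lclass \1_A) = \int[mu]_x (g x * \1_A x)) ->
  l (Lclass s) = \int[mu]_x (g x * s x).
Proof.
move=> gi gE.
have gindic A : measurable A -> mu.-integrable setT (EFin \o (fun x => g x * \1_A x)).
  move=> mA; have := @integrableMl _ _ _ mu setT measurableT _ (\1_A : T -> R) gi.
  apply=> //; exists 1; split=> // y y1 x _.
  by rewrite /= indicE; case: (x \in A); rewrite /= ?normr1 ?normr0 ltW// (lt_trans _ y1).
(* The range of [s] is generalised to an arbitrary list of values to allow induction; integrability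
   is carried along because splitting the integral of a sum requires it. *)
pose t (r : seq R) x : R := \sum_(y <- r) y * \1_(s @^-1` [set y]) x.
suff tP (r : seq R) : [/\ t r \in Lfun mu 2%:E,
    mu.-integrable setT (EFin \o (fun x => g x * t r x)) &
    l (Lclass (t r)) = \int[mu]_x (g x * t r x)].
  have -> : (s : T -> R) = t (finmap.enum_fset (fset_set (range s))).
    by apply/funext => x; rewrite fimfunE fsbig_finite.
  by have [] := tP (finmap.enum_fset (fset_set (range s))).
elim: r => [|y r [lt it tE]].
  have -> : t [::] = fun=> 0 by apply/funext => x; rewrite /t big_nil.
  under eq_Rintegral do rewrite mulr0.
  rewrite Lspace_class0 l0 /Rintegral integral0; split=> //.
    by apply: (@bounded_Lfun2 _ 0) => // x; rewrite normr0.
  by under eq_fun do rewrite /= mulr0; exact: integrable0.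
pose B := s @^-1` [set y].
have mB : measurable B by exact: measurable_sfunP.
have -> : t (y :: r) = fun x => y * \1_B x + t r x.
  by apply/funext => x; rewrite /t big_cons.
have lB1 : (fun x => y * \1_B x) \in Lfun mu 2%:E by apply: Lfun2Z; exact: indic_Lfun2.
have iB : mu.-integrable setT (EFin \o (fun x => y * (g x * \1_B x))).
  exact: (integrableZl measurableT y (gindic _ mB)).
have gtE : (fun x => g x * (y * \1_B x + t r x)) =
    (fun x => y * (g x * \1_B x) + g x * t r x).
  by apply/funext => x; ring.
split; first exact: Lfun2D.
  by rewrite gtE; exact: (integrableD measurableT iB it).
rewrite Lspace_classD// lD tE -/B gtE RintegralD//; congr (_ + _).
rewrite RintegralZl//; last exact: gindic.
by rewrite -gE// -lZ Lspace_classZ//; exact: indic_Lfun2.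
Qed.

Lemma integrable_mul_nnsfun (g : T -> R) (s : {nnsfun T >-> R}) :
  mu.-integrable setT (EFin \o g) ->
  mu.-integrable setT (EFin \o (fun x => g x * s x)).
Proof.
move=> gi; have := @integrableMl _ _ _ mu setT measurableT _ (s : T -> R) gi.
apply=> //; have [C [Cr sC]] := simple_bounded s.
by exists C; split=> // y Cy x _; exact: sC.
Qed.

(** Kept general in [g] and [K] so as to serve both the density and its opposite. Simple functions
    [s n] increasing to [g^\+] satisfy [s n ^ 2 <= g * s n], which bounds the integrals of [s n ^ 2]
    by [K ^ 2]; monotone convergence passes this bound to [g^\+]. *)
Let funrpos_Lfun2 (g : T -> R) (K : R) : mu.-integrable setT (EFin \o g) ->
  (forall s : {nnsfun T >-> R}, `|\int[mu]_x (g x * s x)| <= K * `|Lclass s|) ->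
  g^\+ \in Lfun mu 2%:E.
Proof.
move=> gi gK.
have mg : measurable_fun setT g by apply/measurable_EFinP; exact: measurable_int gi.
have mgp : measurable_fun setT g^\+ by exact: measurable_funrpos.
have mgpE : measurable_fun setT (EFin \o g^\+) by exact/measurable_EFinP.
have gp0 x : [set: T] x -> (0%R <= (EFin \o g^\+%R) x)%E by move=> _; rewrite lee_fin funrpos_ge0.
pose s n := nnsfun_approx measurableT mgpE n.
have s_le n x : s n x <= g^\+ x.
  by rewrite -lee_fin nnsfun_approxE; exact: le_approx.
have sK n : (\int[mu]_x (s n x ^+ 2)%:E <= (K ^+ 2)%:E)%E.
  rewrite -Lspace_class_norm_sqr ?nnsfun_Lfun2// lee_fin.
  set N := `|_|; have N0 : 0 <= N by exact: normr_ge0.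
  (* Indeed [K ^ 2 >= 2 * K * N - N ^ 2 >= N ^ 2], with no division by [N], which may vanish. *)
  suff H : N ^+ 2 <= K * N by move: H; have := sqr_ge0 (K - N); nra.
  apply: le_trans (gK (s n)); rewrite (le_trans _ (ler_norm _))//.
  rewrite -[N ^+ 2]/(fine (N ^+ 2)%:E) Lspace_class_norm_sqr ?nnsfun_Lfun2//.
  apply: le_Rintegral => //.
  - by apply: Lfun2_integrable_sqr; exact: nnsfun_Lfun2.
  - exact: integrable_mul_nnsfun.
  (* Where [g <= 0], [s n] is squeezed to 0; elsewhere [s n <= g]. *)
  - move=> x _; have := s_le n x; have : 0 <= s n x by [].
    by rewrite /funrpos; case: (leP (g x) 0) => ? ? ?; nra.
apply: Lfun2_sqr_lty => //; apply: (@le_lt_trans _ _ (K ^+ 2)%:E); last exact: ltry.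
have cvI : (\int[mu]_x (s n x ^+ 2)%:E)%E @[n --> \oo] --> (\int[mu]_x (g^\+%R x ^+ 2)%:E)%E.
  rewrite [X in _ --> X](_ : _ = \int[mu]_x limn (fun n => (s n x ^+ 2)%:E))%E; last first.
    apply: eq_integral => x _; apply/esym/cvg_lim => //; apply: cvg_EFin; first exact: nearW.
    apply: (@cvg_comp _ _ _ _ (fun y : R => y ^+ 2)); last exact: exprn_continuous.
    by have /fine_cvgP[] := cvg_nnsfun_approx measurableT mgpE gp0 (I : [set: T] x).
  apply: cvg_monotone_convergence => //.
  - by move=> n; apply/measurable_EFinP; exact: measurable_funX.
  - by move=> n x _; rewrite lee_fin sqr_ge0.
  - move=> x _ m n mn; rewrite lee_fin lerXn2r ?nnegrE//.
    by have /lefP := nd_nnsfun_approx measurableT mgpE mn; exact.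
rewrite -(cvg_lim _ cvI)//; apply: lime_le; last by apply: nearW => n; exact: sK.
by apply/cvg_ex; eexists; exact: cvI.
Qed.

(** The density [g] is square integrable since both its positive and its negative part are. The
    formula, known on simple functions, extends to nonnegative [h] by dominated convergence on both
    sides, then to [u] through its positive and negative parts. *)
Lemma Lspace2_riesz : exists eta : L2, forall u : L2, l u = \int[mu]_x (eta x * u x).
Proof.
have [g [gi gE]] := l_density.
have gs s : l (Lclass (s : {nnsfun T >-> R})) = \int[mu]_x (g x * s x).
  exact: l_nnsfun.
have lg : g \in Lfun mu 2%:E.
  have lgp : g^\+ \in Lfun mu 2%:E.
    by apply: (@funrpos_Lfun2 _ M) => // s; rewrite -gs.
  have lgn : (\- g)^\+ \in Lfun mu 2%:E.
    apply: (@funrpos_Lfun2 _ M).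
      exact: (integrableN gi).
    move=> s; under eq_Rintegral do rewrite mulNr -mulN1r.
    rewrite RintegralZl//; last exact: integrable_mul_nnsfun.
    by rewrite mulN1r normrN -gs.
  rewrite (_ : g = fun x => g^\+ x + -1 * (\- g)^\+ x); first by apply: Lfun2D => //; exact: Lfun2Z.
  by apply/funext => x; rewrite /funrpos /=; case: (leP (g x) 0) => ?; case: (leP (- g x) 0) => ?; lra.
exists (Lclass g).
have mul_i (f h : T -> R) : f \in Lfun mu 2%:E -> h \in Lfun mu 2%:E ->
    mu.-integrable setT (EFin \o (fun x => f x * h x)).
  by move=> lf lh; exact/Lfun1_integrable/Lfun2_mul_Lfun1.
have pos (h : T -> R) : h \in Lfun mu 2%:E -> (forall x, 0 <= h x) ->
    l (Lclass h) = \int[mu]_x (g x * h x).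
  move=> lh h0.
  have mh := Lfun2_measurable lh.
  have mhE : measurable_fun setT (EFin \o h) by exact/measurable_EFinP.
  have h0E x : [set: T] x -> (0%R <= (EFin \o h) x)%E by move=> _; rewrite lee_fin.
  pose s n := nnsfun_approx measurableT mhE n.
  have s_le n x : `|s n x| <= h x.
    by rewrite ger0_norm// -lee_fin nnsfun_approxE; exact: le_approx.
  have s_h x : s ^~ x @ \oo --> h x.
    by have /fine_cvgP[] := cvg_nnsfun_approx measurableT mhE h0E (I : [set: T] x).
  have [_ ls /l_cvg cv] := Lspace_class_dominated_cvg
    (fun n => @measurable_funPT _ _ _ _ (s n)) s_h lh s_le.
  rewrite -(cvg_lim _ cv)//; apply/cvg_lim => //.
  under eq_fun do rewrite gs.
  apply: fine_cvg; rewrite fineK; last exact: (integrable_fin_num measurableT (mul_i _ _ lg lh)).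
  apply: (@dominated_cvg _ _ _ mu setT measurableT _ _ (fun x => `|g x * h x|%:E)) => //.
  - by move=> n; apply/measurable_EFinP; apply: measurable_funM => //; exact: Lfun2_measurable lg.
  - move=> x _; apply: cvg_EFin; first exact: nearW.
    by apply: cvgM; [exact: cvg_cst|exact: s_h].
  - exact: integrable_norm (mul_i _ _ lg lh).
  - move=> n x _; rewrite abse_EFin lee_fin !normrM ler_wpM2l// (le_trans (s_le n x))//.
    exact: ler_norm.
move=> u; have lu := Lspace_Lfun2 u; have mu_ := Lfun2_measurable lu.
have lup : (u : T -> R)^\+ \in Lfun mu 2%:E.
  apply: le_Lfun2 lu _; first exact: measurable_funrpos.
  by move=> x; rewrite /funrpos; case: (leP (u x) 0) => u0; rewrite ?normr0 ?normr_ge0.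
have lun : (u : T -> R)^\- \in Lfun mu 2%:E.
  apply: le_Lfun2 lu _; first exact: measurable_funrneg.
  by move=> x; rewrite /funrneg; case: (leP (- u x) 0) => u0; rewrite ?normr0 ?normr_ge0// normrN.
have uE : (u : T -> R) = fun x => (u : T -> R)^\+ x + -1 * (u : T -> R)^\- x.
  apply/funext => x; rewrite /funrpos /funrneg.
  by case: (leP (u x) 0) => u0; case: (leP (- u x) 0) => ?; lra.
transitivity (\int[mu]_x (g x * u x)).
  rewrite -[u in LHS]Lspace_classK uE Lspace_classD//; last exact: Lfun2Z.
  rewrite Lspace_classZ// lD lZ !pos//.
  rewrite -RintegralZl//; last exact: mul_i.
  rewrite -RintegralD//; [|exact: mul_i|].
    by apply: eq_Rintegral => x _; ring.
  exact: (integrableZl measurableT (-1) (mul_i _ _ lg lun)).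
congr fine; apply: ae_eq_integral => //.
- by apply/measurable_EFinP; apply: measurable_funM => //; exact: Lfun2_measurable lg.
- apply/measurable_EFinP; apply: measurable_funM => //.
  exact/Lfun2_measurable/Lspace_Lfun2.
- by apply: filterS (Lspace_classE lg) => x gx _; rewrite (gx I).
Qed.

End riesz.

(** * Tangent bounds for [|s| ^ p] and one-sided difference quotients *)

Section power_penalty.
Context {R : realType}.
Implicit Types a b u v p : R.

(* Young's inequality for [b ^ p * a ^ (1 - p)] with exponents [1 / p] and
   [1 / (1 - p)]. *)
Lemma powR_le_tangent p a b : 0 < p < 1 -> 0 < a -> 0 <= b ->
  b `^ p <= a `^ p + p * a `^ (p - 1) * (b - a).
Proof.
move=> /andP[p0 p1] a0 b0.
have q0 : 0 < 1 - p by rewrite subr_gt0.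
have young : b `^ p * a `^ (1 - p) <= p * b + (1 - p) * a.
  have := @conjugate_powR R (b `^ p) (a `^ (1 - p)) p^-1 (1 - p)^-1.
  rewrite !powR_ge0 !invr_gt0 !invrK p0 q0 -!powRrM !mulfV ?gt_eqF// !powRr1 ?(ltW a0)//.
  by rewrite subrKC [b * p]mulrC [a * _]mulrC; exact.
(* Multiplying Young's inequality by [a ^ (p - 1)] isolates [b ^ p] on the left and produces the
   tangent line at [a] on the right. *)
have aE : a `^ (1 - p) * a `^ (p - 1) = 1.
  rewrite -powRD; last by rewrite (gt_eqF a0) implybT.
  by rewrite (_ : 1 - p + (p - 1) = 0) ?powRr0//; ring.
have apE : a `^ p = a `^ (p - 1) * a.
  by rewrite -[X in _ * X]powRr1 ?ltW// -powRD ?subrK// (gt_eqF a0) implybT.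
rewrite -[b `^ p]mulr1 -[X in _ * X <= _]aE mulrA.
apply: (le_trans (ler_wpM2r (powR_ge0 a (p - 1)) young)).
by rewrite apE le_eqVlt; apply/orP; left; apply/eqP; ring.
Qed.

(** The condition [|v - u| <= |u|] prevents [v] from crossing zero, so
    [|u| * (|v| - |u|) = u * (v - u)] and the tangent bound at [|u|] applies to [|v|]. *)
Lemma normr_powR_le_tangent p u v : 0 < p < 1 -> u != 0 -> `|v - u| <= `|u| ->
  `|v| `^ p <= `|u| `^ p + p * `|u| `^ (p - 2) * u * (v - u).
Proof.
move=> hp u0 vu.
have n0 : 0 < `|u| by rewrite normr_gt0.
have E : `|u| `^ (p - 1) = `|u| `^ (p - 2) * `|u|.
  rewrite -[X in _ * X]powRr1// -powRD; first by congr (_ `^ _); ring.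
  by rewrite (gt_eqF n0) implybT.
apply: (le_trans (powR_le_tangent hp n0 (normr_ge0 v))); rewrite lerD2l E.
rewrite le_eqVlt; apply/orP; left; apply/eqP.
suff : `|u| * (`|v| - `|u|) = u * (v - u) by move=> H; rewrite -!mulrA H.
move: vu; case: (ltrgtP u 0) u0 => // uu _.
  rewrite (ltr0_norm uu) ler_norml => /andP[h1 h2].
  by rewrite ler0_norm; [ring|lra].
rewrite (gtr0_norm uu) ler_norml => /andP[h1 h2].
by rewrite ger0_norm; [ring|lra].
Qed.

(** The slope has modulus [p * |u| ^ (p - 1)], which decreases in [|u|] because [p < 1]. *)
Lemma normr_powR_deriv_le p u a : 0 < p < 1 -> 0 < a <= `|u| ->
  `|p * `|u| `^ (p - 2) * u| <= p * a `^ (p - 1).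
Proof.
move=> /andP[p0 p1] /andP[a0 au].
have u0 : 0 < `|u| by exact: lt_le_trans au.
rewrite !normrM (gtr0_norm p0) (ger0_norm (powR_ge0 _ _)) -mulrA ler_pM2l//.
rewrite -[X in _ * X]powRr1// -powRD; last by rewrite (gt_eqF u0) implybT.
rewrite (_ : p - 2 + 1 = - (1 - p)); last by ring.
rewrite (_ : p - 1 = - (1 - p)); last by ring.
rewrite !powRN lef_pV2 ?posrE ?powR_gt0//.
by apply: ge0_ler_powR; rewrite ?nnegrE ?subr_ge0 // ltW.
Qed.

(** Tangent at 1. It makes the penalty of an [L2] function integrable over a finite measure. *)
Lemma normr_powR_le1D p u : 0 < p < 1 -> `|u| `^ p <= 1 + `|u|.
Proof.
move=> hp; apply: (le_trans (powR_le_tangent hp ltr01 (normr_ge0 u))).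
by rewrite !powR1 mulr1; move: hp (normr_ge0 u) => /andP[]; nra.
Qed.

End power_penalty.

(** For small [t > 0] the difference quotient is at least [- c], and it tends to ['d f u h]. The
    number [c] will be the slope of a linear upper bound on the growth of the penalty. *)
Lemma diff_right_quotient_ge0 (R : realType) (V : normedModType R) (f : V -> R)
    (u h : V) (c : R) : differentiable f u ->
  (\forall t \near 0^'+, f u <= f (t *: h + u) + t * c) -> 0 <= 'd f u h + c.
Proof.
move=> df fc.
have : (fun t => t^-1 *: ((f \o shift u) (t *: h) - f u)) @ 0^'+ --> 'd f u h.
  rewrite -deriveE//.
  have dfh : (fun t => t^-1 *: ((f \o shift u) (t *: h) - f u)) @ 0^' --> 'D_h f u.
    exact: (diff_derivable (v := h) df).
  apply: cvg_trans _ dfh.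
  apply: cvg_app => A A0.
  have {}A0 : \forall y \near (0 : R), y != 0 -> A y by exact: A0.
  suff : \forall y \near (0 : R), 0 < y -> A y by [].
  by apply: filterS A0 => y Ay y0; apply: Ay; rewrite gt_eqF.
move=> /cvgr_to_ge H; rewrite -lerBlDr sub0r; apply: H.
near=> t.
have t0 : 0 < t by near: t; exact: nbhs_right_gt.
rewrite /= -[_ *: _]/(_ * _) mulrC ler_pdivlMr// mulrC.
suff : f u <= f (t *: h + u) + t * c by lra.
by near: t.
Unshelve. all: by end_near. Qed.

Lemma measurable_normr_powR d (T : measurableType d) (R : realType)
    (v : T -> R) (e : R) :
  measurable_fun setT v -> measurable_fun setT (fun x => `|v x| `^ e).
Proof.
move=> mv; apply: (@measurableT_comp _ _ _ _ _ _ (@powR R ^~ e)) => //.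
exact: measurableT_comp.
Qed.

(** * Almost-everywhere inequalities for the multiplier *)

Section one_sided_optimality.
Context d (T : measurableType d) (R : realType) (mu : {measure set T -> \bar R}).
Hypothesis muT : mu setT \is a fin_num.
Local Notation L2 := (LspaceType2 mu).
Variables (p : R) (f : L2 -> R) (ua ub u eta : L2).
Hypothesis hp : 0 < p < 1.
Hypothesis df : differentiable f u.
Hypothesis u_min : local_minimizer
  [set v : L2 | {ae mu, forall x, ua x <= v x <= ub x}]
  (fun v : L2 => f v + \int[mu]_x (`|v x| `^ p)) u.
Hypothesis eta_grad : forall h : L2, 'd f u h + \int[mu]_x (eta x * h x) = 0.

Let psi x := p * `|u x| `^ (p - 2) * u x.

Let mL2 (v : L2) : measurable_fun setT v.
Proof. exact/Lfun2_measurable/Lspace_Lfun2. Qed.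
#[local] Hint Extern 0 (measurable_fun _ _) => solve [apply: mL2] : core.

Let mpsi : measurable_fun setT psi.
Proof. by apply: measurable_funM => //; apply: measurable_funM => //; exact: measurable_normr_powR. Qed.

Let int_L2 (v : T -> R) : v \in Lfun mu 2%:E -> mu.-integrable setT (EFin \o v).
Proof. by move=> lv; exact/Lfun1_integrable/Lfun_subset12. Qed.

Let int_pow (v : T -> R) : v \in Lfun mu 2%:E ->
  mu.-integrable setT (EFin \o (fun x => `|v x| `^ p)).
Proof.
move=> lv; have mv := Lfun2_measurable lv.
have l1 : (cst 1 : T -> R) \in Lfun mu 2%:E.
  by apply: (@bounded_Lfun2 _ _ _ mu muT _ 1) => // x /=; rewrite normr1.
have lnv : (fun x => `|v x|) \in Lfun mu 2%:E.
  by apply: le_Lfun2 lv _ => [|x]; [exact: measurableT_comp|rewrite normr_id].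
apply: le_integrable (int_L2 (Lfun2D l1 lnv)) => //=.
  by apply/measurable_EFinP; exact: measurable_normr_powR.
move=> x _; rewrite lee_fin ger0_norm ?powR_ge0// (le_trans (normr_powR_le1D _ hp))//.
exact: ler_norm.
Qed.

(** The condition [|r| <= |u x|] serves twice: it keeps [u x + t * r] from crossing zero, as the
    tangent bound requires, and it bounds [psi] on the perturbed set, away from its blow-up near the
    zeros of [u]. *)
Lemma ae_one_sided_optimality (r : R) : r != 0 ->
  {ae mu, forall x, ua x <= u x + r <= ub x -> `|r| <= `|u x| ->
    0 <= r * (p * `|u x| `^ (p - 2) * u x - eta x)}.
Proof.
move=> r0.
have [u_feas u_near] := u_min.
have u_feasible : {ae mu, forall x, ua x <= u x <= ub x} by exact: u_feas.
have nr0 : 0 < `|r| by rewrite normr_gt0.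
(* The points violating the claim, as a boolean test so that measurability reduces to that of
   comparisons. *)
pose b x := [&& ua x <= u x + r, u x + r <= ub x, `|r| <= `|u x| & r * (psi x - eta x) < 0].
pose B := b @^-1` [set true].
have mB : measurable B.
  rewrite -[B]setTI; apply: (_ : measurable_fun setT b) => //.
  apply: measurable_and; first by apply: measurable_fun_ler => //; exact: measurable_funD.
  apply: measurable_and; first by apply: measurable_fun_ler => //; exact: measurable_funD.
  apply: measurable_and; first by apply: measurable_fun_ler => //; exact: measurableT_comp.
  apply: measurable_fun_ltr => //; apply: measurable_funM => //; exact: measurable_funB.
pose h0 x := r * \1_B x : R.
have lh0 : h0 \in Lfun mu 2%:E by apply: Lfun2Z; exact: indic_Lfun2.
pose h : L2 := Lspace_class mu h0.
have hE : (h : T -> R) = h0 %[ae mu] by exact: Lspace_classE.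
have h0B x : B x -> h0 x = r by move=> Bx; rewrite /h0 indicE mem_set// mulr1.
have h0nB x : ~ B x -> h0 x = 0 by move=> Bx; rewrite /h0 indicE memNset// mulr0.
have psih : (fun x => psi x * h0 x) \in Lfun mu 2%:E.
  apply: (@bounded_Lfun2 _ _ _ mu muT _ (p * `|r| `^ (p - 1) * `|r|)).
    by apply: measurable_funM => //; exact: Lfun2_measurable lh0.
  move=> x; have [Bx|nBx] := pselect (B x); last first.
    rewrite h0nB// mulr0 normr0 !mulr_ge0 ?powR_ge0//.
    by case/andP: hp => /ltW.
  rewrite h0B// normrM ler_wpM2r// normr_powR_deriv_le// nr0.
  by move: Bx => /and4P[].
pose c := \int[mu]_x (psi x * h0 x).
have q_le t : 0 < t < 1 ->
    \int[mu]_x (`|(t *: h + u : L2) x| `^ p) <= \int[mu]_x (`|u x| `^ p) + t * c.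
  move=> /andP[t0 t1].
  have lw : (fun x => u x + t * h0 x) \in Lfun mu 2%:E.
    by apply: Lfun2D; [exact: Lspace_Lfun2|exact: Lfun2Z].
  rewrite [leLHS](_ : _ = \int[mu]_x (`|u x + t * h0 x| `^ p)); last first.
    congr fine; apply: ae_eq_integral => //.
    - by apply/measurable_EFinP; exact: measurable_normr_powR.
    - by apply/measurable_EFinP; apply: measurable_normr_powR; exact: Lfun2_measurable lw.
    - move: (Lspace_addE (t *: h) u) (Lspace_scaleE t h) hE.
      by apply: filterS3 => x E1 E2 E3 _; rewrite (E1 I) (E2 I) (E3 I) addrC.
  rewrite /c -RintegralZl//; last exact: int_L2 psih.
  have ipsi := int_L2 (Lfun2Z t psih).
  have iu := int_pow (Lspace_Lfun2 u).
  rewrite -RintegralD//.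
  apply: le_Rintegral => //; first exact: int_pow lw.
    exact: (integrableD measurableT iu ipsi).
  (* Off [B] both integrands agree; on [B] this is the tangent bound at [u x] with increment
     [t * r]. *)
  move=> x _; have [Bx|nBx] := pselect (B x); last first.
    by rewrite h0nB// !mulr0 !addr0.
  rewrite h0B//; have /and4P[_ _ rux _] := Bx.
  have ux0 : u x != 0 by rewrite -normr_gt0 (lt_le_trans nr0).
  have -> : t * (psi x * r) = psi x * (u x + t * r - u x) by ring.
  apply: normr_powR_le_tangent => //.
  rewrite (_ : u x + t * r - u x = t * r); last by ring.
  by rewrite normrM (gtr0_norm t0) (le_trans _ rux)// ler_piMl// ltW.
(* On [B], [u + t * r] lies between [u] and [u + r], both within the bounds; off [B] nothing
   moves. *)
have feas t : 0 < t < 1 -> {ae mu, forall x, ua x <= (t *: h + u : L2) x <= ub x}.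
  move=> /andP[t0 t1].
  move: (Lspace_addE (t *: h) u) (Lspace_scaleE t h) => addE scaleE.
  apply: filterS2 (filterI addE scaleE) (filterI hE u_feasible).
  move=> x [E1 E2] [E3 ux]; rewrite (E1 I) (E2 I) (E3 I).
  have [Bx|nBx] := pselect (B x); last by rewrite h0nB// mulr0 add0r.
  rewrite h0B//; have /and4P[h1 h2 _ _] := Bx; case/andP: ux => h3 h4.
  by apply/andP; split; nra.
have dfc : 0 <= 'd f u h + c.
  apply: diff_right_quotient_ge0 => //.
  have thu : t *: h + u @[t --> (0 : R)^'+] --> u.
    rewrite -[X in _ --> X]add0r; apply: cvgD; last exact: cvg_cst.
    rewrite -[X in _ --> X](scale0r h); apply: cvgZl.
    by apply: cvg_at_right_filter; exact: cvg_id.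
  near=> t.
  have t01 : 0 < t < 1.
    by apply/andP; split; near: t; [exact: nbhs_right_gt|exact: nbhs_right_lt].
  have : f u + \int[mu]_x (`|u x| `^ p) <=
      f (t *: h + u) + \int[mu]_x (`|(t *: h + u : L2) x| `^ p).
    by move: (feas t t01); near: t; exact: thu u_near.
  have aux (F G q1 q2 e : R) : F + q1 <= G + q2 -> q2 <= q1 + e -> F <= G + e by lra.
  by move=> /aux; apply; exact: q_le.
have etah : \int[mu]_x (eta x * h x) = \int[mu]_x (eta x * h0 x).
  congr fine; apply: ae_eq_integral => //.
  - by apply/measurable_EFinP; exact: measurable_funM.
  - apply/measurable_EFinP; apply: measurable_funM => //; exact: Lfun2_measurable lh0.
  - by apply: filterS hE => x hx _; rewrite (hx I).
have ieta : mu.-integrable setT (EFin \o (fun x => eta x * h0 x)).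
  by apply/Lfun1_integrable; apply: Lfun2_mul_Lfun1 => //; exact: Lspace_Lfun2.
(* [k] is nonnegative and strictly positive on [B], while its integral is [- ('d f u h + c) <= 0].
   It thus vanishes almost everywhere, and [B] is null. *)
pose k x := eta x * h0 x - psi x * h0 x.
have kE x : k x = - (r * (psi x - eta x)) * \1_B x by rewrite /k /h0; ring.
have k0 x : 0 <= k x.
  rewrite kE; have [Bx|nBx] := pselect (B x); last by rewrite indicE memNset// mulr0.
  rewrite indicE mem_set// mulr1 oppr_ge0; have /and4P[_ _ _ /ltW] := Bx; exact.
have ik : mu.-integrable setT (EFin \o k).
  exact: (integrableB measurableT ieta (int_L2 psih)).
have intk : \int[mu]_x k x <= 0.
  rewrite RintegralB//; last exact: int_L2 psih.
  by move: (eta_grad h) dfc; rewrite etah /c; lra.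
have : {ae mu, forall x, k x = 0}.
  have : (\int[mu]_x `|(k x)%:E|)%E = 0%E.
    under eq_integral do rewrite gee0_abs ?lee_fin//.
    apply/eqP; rewrite eq_le integral_ge0 ?andbT; last by move=> x _; rewrite lee_fin.
    by rewrite -[leLHS]fineK ?lee_fin//; exact: integrable_fin_num.
  move/ae_eq_integral_abs => /(_ measurableT (measurable_int _ ik)).
  by apply: filterS => x /(_ I) [].
apply: filterS => x kx /andP[h1 h2] h3; rewrite leNgt; apply/negP => h4.
have Bx : B x by rewrite /B /= /b h1 h2 h3.
by move: kx; rewrite kE indicE mem_set// mulr1 => /eqP; rewrite oppr_eq0 lt_eqF.
Unshelve. all: by end_near. Qed.

Let small_inv (e : R) : 0 < e -> exists k : nat, k.+1%:R^-1 < e.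
Proof.
move=> e0; have [k _ /(_ k (leqnn _)) ke] := near_infty_natSinv_lt (PosNum e0).
by exists k.
Qed.

Lemma ae_multiplier_le : {ae mu, forall x, u x != 0 -> u x < ub x ->
  eta x <= p * `|u x| `^ (p - 2) * u x}.
Proof.
have [u_feas _] := u_min.
(* Countably many step lengths [1 / (k + 1)] share one exceptional null set; at a given point some
   step is below both [ub x - u x] and [|u x|]. *)
have step k := @ae_one_sided_optimality k.+1%:R^-1 (invr_neq0 (lt0r_neq0 (ltr0Sn R k))).
apply: filterS2 u_feas (ae_foralln step) => x /andP[ax xb] opt ux0 uxb.
have [] := @small_inv (Num.min (ub x - u x) `|u x|).
  by rewrite lt_min subr_gt0 uxb normr_gt0.
move=> k; rewrite lt_min => /andP[k1 k2].
have k0 : 0 < k.+1%:R^-1 :> R by rewrite invr_gt0.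
have := opt k; rewrite (gtr0_norm k0) (ltW k2) pmulr_rge0// subr_ge0; apply=> //.
by move: k.+1%:R^-1 k1 k0 => e k1 k0; apply/andP; split; lra.
Qed.

(** The same argument with downward steps; dividing by a negative [r] reverses the inequality. *)
Lemma ae_multiplier_ge : {ae mu, forall x, u x != 0 -> ua x < u x ->
  p * `|u x| `^ (p - 2) * u x <= eta x}.
Proof.
have [u_feas _] := u_min.
have neq0 k : - (k.+1%:R^-1) != 0 :> R by rewrite oppr_eq0 invr_neq0 ?lt0r_neq0.
have step k := @ae_one_sided_optimality _ (neq0 k).
apply: filterS2 u_feas (ae_foralln step) => x /andP[ax xb] opt ux0 uxa.
have [] := @small_inv (Num.min (u x - ua x) `|u x|).
  by rewrite lt_min subr_gt0 uxa normr_gt0.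
move=> k; rewrite lt_min => /andP[k1 k2].
have k0 : 0 < k.+1%:R^-1 :> R by rewrite invr_gt0.
have := opt k; rewrite normrN (gtr0_norm k0) (ltW k2) mulNr oppr_ge0 pmulr_rle0//.
rewrite subr_le0; apply=> //.
by move: k.+1%:R^-1 k1 k0 => e k1 k0; apply/andP; split; lra.
Qed.

End one_sided_optimality.

(** * Restriction to [D] and finite measure of bounded sets *)

Section restricted_measure.
Context d (T : measurableType d) (R : realType) (mu : {measure set T -> \bar R}).
Variables (D : set T) (mD : measurable D).

(** The complement of [D] is null for the restriction: exceptional sets are cut down to [D] in one
    direction and enlarged by that complement in the other. *)
Lemma ae_mrestr (P : T -> Prop) :
  {ae mrestr mu mD, forall x, P x} <-> {ae mu, forall x, D x -> P x}.
Proof.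
split=> -[N [mN N0 PN]].
  exists (N `&` D); split => //; first exact: measurableI.
  by move=> x /= /not_implyP[Dx nPx]; split=> //; exact: PN.
exists (N `|` ~` D); split.
- by apply: measurableU => //; exact: measurableC.
- rewrite /mrestr setIUl setICl setU0; apply: (subset_measure0 _ mN _ N0) => //.
  exact: measurableI.
- by move=> x /= nPx; have [Dx|] := pselect (D x); [left; apply: PN => /= /(_ Dx)|right].
Qed.

Lemma Rintegral_mrestr (f : T -> R) : measurable_fun setT f ->
  \int[mrestr mu mD]_x f x = \int[mu]_(x in D) f x.
Proof.
move=> mf; transitivity (\int[mrestr mu mD]_(x in D) f x); last first.
  congr fine; apply: eq_measure_integral => A mA AD.
  by rewrite /= /mrestr (setIidl AD).
rewrite [RHS]Rintegral_mkcond; congr fine; apply: ae_eq_integral => //.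
- exact/measurable_EFinP.
- by apply/measurable_EFinP/(measurable_restrictT _ mD)/measurable_funTS.
- by apply/ae_mrestr/aeW => x Dx _; rewrite patchE mem_set.
Qed.

End restricted_measure.

Lemma normr_coord_le (R : realDomainType) (m n : nat) (x : 'M[R]_(m, n)) i j :
  `|x i j| <= `|x|.
Proof.
rewrite [leRHS]mx_normrE.
exact: (le_bigmax _ (fun ij : 'I_m * 'I_n => `|x ij.1 ij.2|) (i, j)).
Qed.

Lemma bounded_lebesgue_rV_lty (R : realType) (n : nat) (D : set 'rV[R]_n.+1) :
  bounded_set D -> (@lebesgue_rV R n D < +oo)%E.
Proof.
move=> [M [_ DM]].
(* Boundedness controls the norm by any number above [M]; this one is moreover positive. *)
pose c := `|M| + 1.
have Dc x : D x -> `|x| <= c by move/DM; apply; rewrite (le_lt_trans (ler_norm M))// ltrDl.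
(* Boxes are half-open, so the upper corner is moved to [c + 1] to include coordinates equal to [c].
   The countable cover is this box followed by empty ones of volume 0. *)
pose b : 'rV[R]_n.+1 * 'rV[R]_n.+1 := (const_mx (- c), const_mx (c + 1)).
pose B (k : nat) : 'rV[R]_n.+1 * 'rV[R]_n.+1 := if k == 0%N then b else (0, 0).
have B0 k : (0 < k)%N -> rV_box_vol (B k) = 0.
  by case: k => // k _; rewrite /rV_box_vol /= big_ord_recl subrr maxxx mul0r.
apply: (@le_lt_trans _ _ (rV_box_vol b)%:E); last exact: ltry.
apply: ereal_inf_lbound; exists B.
  move=> x /Dc xc; exists 0%N => // i; rewrite /= !mxE.
  have : `|x 0 i| <= c by apply: le_trans xc; exact: normr_coord_le.
  by rewrite ler_norml => /andP[-> h] /=; lra.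
rewrite nneseries_recl//; last by move=> k _; rewrite lee_fin rV_box_vol_ge0.
by rewrite eseries0 ?adde0// => k k0 _; rewrite B0.
Qed.

(** * The optimality system on the domain *)

Theorem theorem6p18 (R : realType) (d : nat) (D : set 'rV[R]_d.+1)
    (oD : open D) (cD : connected D) (D0 : D !=set0) (bD : bounded_set D)
    (p : R) (hp : 0 < p < 1)
    (f : L2 oD -> R) (hf : continuously_differentiable f)
    (ua ub : L2 oD)
    (hab : {ae lebesgue_rV, forall x, D x -> ua x < 0 < ub x})
    (ubar : L2 oD)
    (hubar : local_minimizer (box_constraint ua ub)
               (fun u => f u + Lp_penalty p u) ubar) :
  exists eta : L2 oD,
    [/\ forall h : L2 oD, 'd f ubar h + L2_dot eta h = 0,
        {ae lebesgue_rV, forall x, D x ->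
          ubar x != 0 -> ua x < ubar x < ub x ->
          eta x = p * `|ubar x| `^ (p - 2) * ubar x},
        {ae lebesgue_rV, forall x, D x ->
          ubar x = ua x -> eta x <= p * `|ua x| `^ (p - 2) * ua x} &
        {ae lebesgue_rV, forall x, D x ->
          ubar x = ub x -> eta x >= p * `|ub x| `^ (p - 2) * ub x}].
Proof.
pose mu := mrestr (@lebesgue_rV R d) (rV_open_measurable oD).
have muT : mu setT \is a fin_num.
  rewrite ge0_fin_numE// /mu /mrestr setTI; exact: bounded_lebesgue_rV_lty.
have [df _] := hf; have dfu := df ubar.
have mL2 (v : L2 oD) : measurable_fun setT (v : caratheodory_type _ -> R).
  exact/Lfun2_measurable/Lspace_Lfun2.
(* The functional to be represented is [- 'd f ubar], so that [eta] enters the stationarity equation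
   with a plus sign. *)
have [M dM] : exists M, forall h, `|- 'd f ubar h| <= M * `|h|.
  have /linear_bounded_continuous/linear_boundedP/pinfty_ex_gt0[M _ dM] :=
    diff_continuous dfu.
  by exists M => h; rewrite normrN.
have dP a v w : - 'd f ubar (a *: v + w) = a * - 'd f ubar v + - 'd f ubar w.
  by rewrite linearP /= opprD -mulrN.
have [eta etaE] := Lspace2_riesz muT dP dM.
have grad (h : L2 oD) : 'd f ubar h + \int[mu]_x (eta x * h x) = 0.
  by rewrite -etaE subrr.
have aeD (P : 'rV[R]_d.+1 -> Prop) :
    {ae mu, forall x, P x} <-> {ae lebesgue_rV, forall x, D x -> P x}.
  exact: ae_mrestr.
(* Constraint and penalty are transferred from [D] to the restricted measure on the whole space. *)
have umin : local_minimizer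
    [set v : L2 oD | {ae mu, forall x, ua x <= v x <= ub x}]
    (fun v : L2 oD => f v + \int[mu]_x (`|v x| `^ p)) ubar.
  have pen (v : L2 oD) : \int[mu]_x (`|v x| `^ p) = Lp_penalty p v.
    exact: (Rintegral_mrestr (@lebesgue_rV R d) (rV_open_measurable oD)
      (measurable_normr_powR p (mL2 v))).
  have [feas near_min] := hubar; split; first exact: (aeD _).2 feas.
  apply: filterS near_min => v vmin v_feas.
  have := vmin ((aeD (fun x => ua x <= v x <= ub x)).1 v_feas).
  by rewrite -!pen.
have eta_le := ae_multiplier_le muT hp dfu umin grad.
have eta_ge := ae_multiplier_ge muT hp dfu umin grad.
have {}hab : {ae mu, forall x, ua x < 0 < ub x} by exact: (aeD _).2 hab.
exists eta; split.
- move=> h; rewrite -[RHS](grad h); congr (_ + _); apply/esym/Rintegral_mrestr.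
  exact: measurable_funM.
(* Strictly between the bounds both one-sided inequalities hold. *)
- apply: (aeD _).1; apply: filterS2 eta_le eta_ge => x le ge u0 /andP[au ub0].
  by apply/eqP; rewrite eq_le le// ge.
(* Where [ubar = ua], the signs [ua < 0 < ub] give [ubar != 0] and [ubar < ub], so the upper
   estimate for [eta] is available; the last case is symmetric. *)
- apply: (aeD _).1; apply: filterS2 eta_le hab => x le /andP[a0 b0] uE.
  by rewrite -uE; apply: le; rewrite uE ?lt_eqF// (lt_trans a0).
- apply: (aeD _).1; apply: filterS2 eta_ge hab => x ge /andP[a0 b0] uE.
  by rewrite -uE; apply: ge; rewrite uE ?gt_eqF// (lt_trans a0).
Qed.
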